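(* Let $\mathbb{C}$ be a majority category. Then every internal groupoid in $\mathbb{C}$ is an equivalence relation; that is, for every internal groupoid in $\mathbb{C}$ with object of objects $G_0$, object of arrows $G_1$ and domain and codomain morphisms $d_0,d_1:G_1\to G_0$, the morphisms $d_0$ and $d_1$ are jointly monomorphic.
   Context: A ternary relation between objects $A,B,C$ of a category is a quadruple $R=(R_0,r_1,r_2,r_3)$ where $r_1:R_0\to A$, $r_2:R_0\to B$, $r_3:R_0\to C$ are jointly monomorphic. For morphisms $a:S\to A$, $b:S\to B$, $c:S\to C$, the triple $(a,b,c)$ is $R$-related if there is a morphism $f:S\to R_0$ with $r_1f=a$, $r_2f=b$, $r_3f=c$. A category $\mathbb{C}$ (not necessarily having finite limits) is a majority category if for any ternary relation $R$ between any objects $A,B,C$ and any morphisms $a_1,a_2:S\to A$, $b_1,b_2:S\to B$, $c_1,c_2:S\to C$: if $(a_1,b_1,c_2)$, $(a_1,b_2,c_1)$ and $(a_2,b_1,c_1)$ are $R$-related, then $(a_1,b_1,c_1)$ is $R$-related. An internal groupoid consists of objects $G_0,G_1$, morphisms $d_0,d_1:G_1\to G_0$ (domain and codomain), $s:G_0\to G_1$ (identities), $\sigma:G_1\to G_1$ (inverses), and $m:G_2\to G_1$ (composition), where $G_2$ is the object of composable pairs, i.e. the pullback of the codomain morphism along the domain morphism (assumed to exist), with projections $p_1,p_2:G_2\to G_1$, satisfying the usual groupoid axioms (unit, associativity and inverse laws). *)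

(* Defs.v *)
Set Implicit Arguments.
Unset Strict Implicit.
Unset Printing Implicit Defensive.

Declare Scope cat_scope.
Delimit Scope cat_scope with cat.

Record Category : Type := {
  Obj :> Type;
  Hom : Obj -> Obj -> Type;
  idm : forall A, Hom A A;
  comp : forall A B D, Hom B D -> Hom A B -> Hom A D;
  comp_idl : forall A B (f : Hom A B), comp (idm B) f = f;
  comp_idr : forall A B (f : Hom A B), comp f (idm A) = f;
  comp_assoc : forall A B D E (h : Hom D E) (g : Hom B D) (f : Hom A B),
    comp h (comp g f) = comp (comp h g) f
}.

Arguments Hom {_} A B.
Arguments idm {_} A.
Arguments comp {_ A B D} g f.

(* g ∘ f : first f, then g *)
Notation "g ∘ f" := (comp g f) (at level 40, left associativity) : cat_scope.
Local Open Scope cat_scope.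

Definition jointly_monic2 (C : Category) (X A B : C)
    (u : Hom X A) (v : Hom X B) : Prop :=
  forall (S : C) (x y : Hom S X),
    u ∘ x = u ∘ y -> v ∘ x = v ∘ y -> x = y.

Definition jointly_monic3 (C : Category) (X A B D : C)
    (u : Hom X A) (v : Hom X B) (w : Hom X D) : Prop :=
  forall (S : C) (x y : Hom S X),
    u ∘ x = u ∘ y -> v ∘ x = v ∘ y -> w ∘ x = w ∘ y -> x = y.

Record TernaryRelation (C : Category) (A B D : C) : Type := {
  rel_obj : C;
  rel1 : Hom rel_obj A;
  rel2 : Hom rel_obj B;
  rel3 : Hom rel_obj D;
  rel_monic : jointly_monic3 rel1 rel2 rel3
}.

Definition related (C : Category) (A B D : C) (R : TernaryRelation A B D)
    (S : C) (a : Hom S A) (b : Hom S B) (c : Hom S D) : Prop :=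
  exists f : Hom S (rel_obj R),
    rel1 R ∘ f = a /\ rel2 R ∘ f = b /\ rel3 R ∘ f = c.

Definition majority_category (C : Category) : Prop :=
  forall (A B D : C) (R : TernaryRelation A B D) (S : C)
    (a1 a2 : Hom S A) (b1 b2 : Hom S B) (c1 c2 : Hom S D),
    related R a1 b1 c2 -> related R a1 b2 c1 -> related R a2 b1 c1 ->
    related R a1 b1 c1.

Definition is_pullback (C : Category) (P X Y Z : C)
    (f : Hom X Z) (g : Hom Y Z) (p : Hom P X) (q : Hom P Y) : Prop :=
  f ∘ p = g ∘ q /\
  forall (S : C) (x : Hom S X) (y : Hom S Y), f ∘ x = g ∘ y ->
    exists! t : Hom S P, p ∘ t = x /\ q ∘ t = y.

(* A composable pair is ordered as (first arrow, second arrow), so m sends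
   (x, y) with cod x = dom y to "x followed by y".
   A morphism t : S -> G2 is the same thing as a composable pair
   (p1 ∘ t, p2 ∘ t) of S-shaped arrows.  The axioms whose usual form uses an
   induced morphism into G2 are stated for every t having the prescribed
   components; such a t exists and is unique by g_pullback.  Associativity
   is required of all composable triples of S-shaped arrows, since the object
   of composable triples need not exist in C. *)
Record InternalGroupoid (C : Category) : Type := {
  G0 : C;
  G1 : C;
  G2 : C;
  d0 : Hom G1 G0;
  d1 : Hom G1 G0;
  s : Hom G0 G1;
  sigma : Hom G1 G1;
  p1 : Hom G2 G1;
  p2 : Hom G2 G1;
  m : Hom G2 G1;
  g_pullback : is_pullback d1 d0 p1 p2;
  g_dom_id : d0 ∘ s = idm G0;
  g_cod_id : d1 ∘ s = idm G0;
  g_dom_comp : d0 ∘ m = d0 ∘ p1;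
  g_cod_comp : d1 ∘ m = d1 ∘ p2;
  g_unit_l : forall t : Hom G1 G2,
    p1 ∘ t = s ∘ d0 -> p2 ∘ t = idm G1 -> m ∘ t = idm G1;
  g_unit_r : forall t : Hom G1 G2,
    p1 ∘ t = idm G1 -> p2 ∘ t = s ∘ d1 -> m ∘ t = idm G1;
  (* xy = (x, y), yz = (y, z), xy_z = (xy, z), x_yz = (x, yz) *)
  g_assoc : forall (S : C) (xy yz xy_z x_yz : Hom S G2),
    p2 ∘ xy = p1 ∘ yz ->
    p1 ∘ xy_z = m ∘ xy -> p2 ∘ xy_z = p2 ∘ yz ->
    p1 ∘ x_yz = p1 ∘ xy -> p2 ∘ x_yz = m ∘ yz ->
    m ∘ xy_z = m ∘ x_yz;
  g_dom_inv : d0 ∘ sigma = d1;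
  g_cod_inv : d1 ∘ sigma = d0;
  g_inv_r : forall t : Hom G1 G2,
    p1 ∘ t = idm G1 -> p2 ∘ t = sigma -> m ∘ t = s ∘ d0;
  g_inv_l : forall t : Hom G1 G2,
    p1 ∘ t = sigma -> p2 ∘ t = idm G1 -> m ∘ t = s ∘ d1
}.

(* Main.v *)
Require Import Defs.

(** Composition of an internal groupoid is a ternary relation on arrows, namely
    [z = x ; y], carried by [G2] with the legs [p1], [p2] and [m].  If [x] and
    [y] are parallel, then the triples

      - [(x, 1, x)], where [1] is the identity on the common codomain,
      - [(x, x^-1 ; y, y)],
      - [(y, 1, y)]

    all belong to it.  The majority property then puts [(x, 1, y)] into the
    relation, which says [y = x ; 1 = x].  Everything happens for generalized
    elements [S -> G1].  The only limit used is [G2], so the argument works in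
    a category without finite limits once the groupoid axioms, stated for the
    generic arrow [idm G1], are transported to arbitrary shapes [S]
    ([comp_unit_l], [comp_unit_r], [comp_inv_r]); cancelling [x] in
    [x ; (x^-1 ; y)] is [comp_inv_cancel]. *)

Set Implicit Arguments.
Unset Strict Implicit.
Unset Printing Implicit Defensive.

Local Open Scope cat_scope.

Section Groupoid.

Variables (C : Category) (G : InternalGroupoid C).

Lemma composable_pair (S : C) (x y : Hom S (G1 G)) :
  d1 G ∘ x = d0 G ∘ y ->
  exists t : Hom S (G2 G), p1 G ∘ t = x /\ p2 G ∘ t = y.
Proof.
  intros e. destruct (g_pullback G) as [_ H].
  destruct (H S x y e) as [t [Ht _]]. now exists t.
Qed.

Lemma composable_pair_monic : jointly_monic2 (p1 G) (p2 G).
Proof.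
  intros S t u e1 e2. destruct (g_pullback G) as [sq H].
  destruct (H S (p1 G ∘ t) (p2 G ∘ t)) as [v [_ uniq]].
  - now rewrite !comp_assoc, sq.
  - transitivity v; [symmetry |]; apply uniq; split; auto.
Qed.

(** A law about the composite of the pair [(a, b)] of endomorphisms of [G1]
    holds at every arrow [x], because the pair [(a ∘ x, b ∘ x)] factors
    through [x]. *)
Lemma law_at_arrow (a b c : Hom (G1 G) (G1 G)) :
  d1 G ∘ a = d0 G ∘ b ->
  (forall t, p1 G ∘ t = a -> p2 G ∘ t = b -> m G ∘ t = c) ->
  forall (S : C) (x : Hom S (G1 G)) (t : Hom S (G2 G)),
    p1 G ∘ t = a ∘ x -> p2 G ∘ t = b ∘ x -> m G ∘ t = c ∘ x.
Proof.
  intros e law S x t e1 e2.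
  destruct (composable_pair e) as [u [u1 u2]].
  assert (tu : t = u ∘ x).
  { apply composable_pair_monic; rewrite comp_assoc.
    - now rewrite u1.
    - now rewrite u2. }
  now rewrite tu, comp_assoc, (law u u1 u2).
Qed.

Lemma comp_unit_l (S : C) (x : Hom S (G1 G)) (t : Hom S (G2 G)) :
  p1 G ∘ t = s G ∘ (d0 G ∘ x) -> p2 G ∘ t = x -> m G ∘ t = x.
Proof.
  intros e1 e2. rewrite <- (comp_idl x).
  apply (law_at_arrow (a := s G ∘ d0 G) (b := idm _)).
  - now rewrite comp_assoc, g_cod_id, comp_idl, comp_idr.
  - apply g_unit_l.
  - now rewrite <- comp_assoc.
  - now rewrite comp_idl.
Qed.

Lemma comp_unit_r (S : C) (x : Hom S (G1 G)) (t : Hom S (G2 G)) :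
  p1 G ∘ t = x -> p2 G ∘ t = s G ∘ (d1 G ∘ x) -> m G ∘ t = x.
Proof.
  intros e1 e2. rewrite <- (comp_idl x).
  apply (law_at_arrow (a := idm _) (b := s G ∘ d1 G)).
  - now rewrite comp_assoc, g_dom_id, comp_idl, comp_idr.
  - apply g_unit_r.
  - now rewrite comp_idl.
  - now rewrite <- comp_assoc.
Qed.

Lemma comp_inv_r (S : C) (x : Hom S (G1 G)) (t : Hom S (G2 G)) :
  p1 G ∘ t = x -> p2 G ∘ t = sigma G ∘ x -> m G ∘ t = s G ∘ (d0 G ∘ x).
Proof.
  intros e1 e2. rewrite comp_assoc.
  apply (law_at_arrow (a := idm _) (b := sigma G)).
  - now rewrite g_dom_inv, comp_idr.
  - apply g_inv_r.
  - now rewrite comp_idl.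
  - exact e2.
Qed.

Lemma comp_inv_cancel (S : C) (x y : Hom S (G1 G)) :
  d0 G ∘ x = d0 G ∘ y ->
  exists (z : Hom S (G1 G)) (t : Hom S (G2 G)),
    p1 G ∘ t = x /\ p2 G ∘ t = z /\ m G ∘ t = y.
Proof.
  intros e.
  destruct (@composable_pair S x (sigma G ∘ x)) as [xx' [a1 a2]].
  { now rewrite comp_assoc, g_dom_inv. }
  destruct (@composable_pair S (sigma G ∘ x) y) as [x'y [b1 b2]].
  { now rewrite comp_assoc, g_cod_inv. }
  destruct (@composable_pair S (m G ∘ xx') y) as [xx'_y [c1 c2]].
  { now rewrite comp_assoc, g_cod_comp, <- comp_assoc, a2, comp_assoc,
      g_cod_inv. }
  destruct (@composable_pair S x (m G ∘ x'y)) as [x_x'y [f1 f2]].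
  { now rewrite (comp_assoc (d0 G)), g_dom_comp, <- comp_assoc, b1,
      comp_assoc, g_dom_inv. }
  exists (m G ∘ x'y), x_x'y. repeat split; auto.
  rewrite <- (@g_assoc C G S xx' x'y xx'_y x_x'y) by congruence.
  apply comp_unit_l; auto.
  rewrite c1, <- e. now apply comp_inv_r.
Qed.

Lemma composition_monic : jointly_monic3 (p1 G) (p2 G) (m G).
Proof.
  intros S t u e1 e2 _. now apply composable_pair_monic.
Qed.

Definition composition_relation : TernaryRelation (G1 G) (G1 G) (G1 G) :=
  Build_TernaryRelation composition_monic.

Lemma composition_unit_r (S : C) (x : Hom S (G1 G)) :
  related composition_relation x (s G ∘ (d1 G ∘ x)) x.
Proof.
  destruct (@composable_pair S x (s G ∘ (d1 G ∘ x))) as [t [t1 t2]].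
  { now rewrite (comp_assoc (d0 G)), g_dom_id, comp_idl. }
  exists t. repeat split; auto. now apply comp_unit_r.
Qed.

End Groupoid.

Theorem theorem3 (C : Category) (hC : majority_category C)
    (G : InternalGroupoid C) :
  jointly_monic2 (d0 G) (d1 G).
Proof.
  intros S x y e0 e1.
  destruct (comp_inv_cancel e0) as [z Hz].
  assert (H : related (composition_relation G) x (s G ∘ (d1 G ∘ x)) y).
  { apply (hC _ _ _ _ _ x y _ z y x).
    - apply composition_unit_r.
    - exact Hz.
    - rewrite e1. apply composition_unit_r. }
  destruct H as [t [t1 [t2 t3]]]; simpl in *.
  rewrite <- t3. symmetry. now apply comp_unit_r.
Qed.
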